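(* The set $\mathcal{B}_{1,2,3}$ consisting of the identities (M1) $(xy)(zt)=(xz)(yt)$, (M2) $(xy)(zt)=(ty)(zx)$, (M3) $((xy)z)t=((xt)z)y$, (M4) $(x(yz))t=(x(tz))y$, (M5) $x((yz)t)=z((yx)t)$, (M6) $x(y(zt))=z(y(xt))$, $(x^2z)y^2=(y^2z)x^2$, and $(zx^2)y^2=(zy^2)x^2$ is an independent basis for $\Sigma_{1,2,3}$.
   Context: $x^2$ denotes $xx$. $\Sigma_{1,2,3}$ is the set of groupoid identities satisfied in the integers $\mathbb{Z}$ by each of the binary operations $x+y$, $x-y$ and $-x+y$. A basis is a set of identities whose equational consequences are exactly $\Sigma_{1,2,3}$; it is independent if no member is a consequence of the others. *)

(* Defs.v *)
From Stdlib Require Import ZArith List.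
Import ListNotations.

Inductive term : Type :=
| Var : nat -> term
| Op : term -> term -> term.

Definition identity : Type := (term * term)%type.

Fixpoint eval {T : Type} (op : T -> T -> T) (v : nat -> T) (t : term) : T :=
  match t with
  | Var n => v n
  | Op a b => op (eval op v a) (eval op v b)
  end.

Definition satisfies {T : Type} (op : T -> T -> T) (e : identity) : Prop :=
  forall v : nat -> T, eval op v (fst e) = eval op v (snd e).

(* e is an equational consequence of the set E of identities: e holds in every
   groupoid satisfying all identities of E (equivalent to derivability by
   Birkhoff's completeness theorem). *)
Definition consequence (E : identity -> Prop) (e : identity) : Prop :=
  forall (T : Type) (op : T -> T -> T),
    (forall d, E d -> satisfies op d) -> satisfies op e.

Definition Sigma123 (e : identity) : Prop :=
  satisfies (fun a b : Z => (a + b)%Z) e /\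
  satisfies (fun a b : Z => (a - b)%Z) e /\
  satisfies (fun a b : Z => (- a + b)%Z) e.

Definition is_basis (B : list identity) (S : identity -> Prop) : Prop :=
  forall e, consequence (fun d => In d B) e <-> S e.

Fixpoint remove_nth {A : Type} (i : nat) (l : list A) : list A :=
  match i, l with
  | _, [] => []
  | O, _ :: l' => l'
  | S i', a :: l' => a :: remove_nth i' l'
  end.

Definition independent (B : list identity) : Prop :=
  forall i, i < length B ->
    forall d, ~ consequence (fun d' => In d' (remove_nth i B)) (nth i B d).

Declare Scope term_scope.
Notation "a * b" := (Op a b) : term_scope.
Delimit Scope term_scope with term.
Definition x := Var 0.
Definition y := Var 1.
Definition z := Var 2.
Definition t := Var 3.
Definition sq (a : term) : term := Op a a.

Local Open Scope term_scope.
Definition M1 : identity := ((x * y) * (z * t), (x * z) * (y * t)).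
Definition M2 : identity := ((x * y) * (z * t), (t * y) * (z * x)).
Definition M3 : identity := (((x * y) * z) * t, ((x * t) * z) * y).
Definition M4 : identity := ((x * (y * z)) * t, (x * (t * z)) * y).
Definition M5 : identity := (x * ((y * z) * t), z * ((y * x) * t)).
Definition M6 : identity := (x * (y * (z * t)), z * (y * (x * t))).
Definition M7 : identity := ((sq x * z) * sq y, (sq y * z) * sq x).
Definition M8 : identity := ((z * sq x) * sq y, (z * sq y) * sq x).
Close Scope term_scope.

Definition B123 : list identity := [M1; M2; M3; M4; M5; M6; M7; M8].

(* Main.v *)
Require Import Defs.
From Stdlib Require Import ZArith List.
From Stdlib Require Import Lia Permutation Bool.
Import ListNotations.

(** The type of a node of a term is the pair of parities of the numbers of left
    and right steps on the way to it. The three operations see, for every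
    variable, the numbers of its occurrences of each type up to multiples of
    (1,-1,-1,1) on the types (00,01,10,11).

    The identities M1-M6 are exactly the swaps of two leaves of equal type in
    terms with four leaves. They make the value of a term depend only on its
    multiset of typed leaves: two ways of building a tree bottom up from this
    multiset start with two cherries, which can be joined by cherries that occur
    together in a common tree, unless a swap in a subtree with four leaves is
    needed. Which trees exist is decided by counting leaves and internal nodes of
    each type. M7 and M8 then exchange x at 10, 01 with y at 00, 11, and, with
    y = uv, move three pairs x, u, v from 10, 01 to 00, 11 at once. Two trees
    differ by a number of pairs divisible by 3, so these moves suffice.

    The countermodels for independence are nilpotent groupoids in which only the
    subterms of one side of the identity, and of the terms that the other
    identities force to be equal to it, are nonzero. *)

(** * Types of nodes *)

Definition ty : Type := (bool * bool)%type.
Definition t00 : ty := (false, false).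
Definition tL (s : ty) : ty := (negb (fst s), snd s).
Definition tR (s : ty) : ty := (fst s, negb (snd s)).
Definition tLR (s : ty) : ty := (negb (fst s), negb (snd s)).
Definition ty_eqb (s r : ty) : bool := eqb (fst s) (fst r) && eqb (snd s) (snd r).

Lemma ty_eqb_eq (s r : ty) : ty_eqb s r = true <-> s = r.
Proof. destruct s as [[] []], r as [[] []]; cbn; split; congruence. Qed.

Lemma tLL (s : ty) : tL (tL s) = s. Proof. now destruct s as [[] []]. Qed.
Lemma tRR (s : ty) : tR (tR s) = s. Proof. now destruct s as [[] []]. Qed.
Lemma tL_tR (s : ty) : tL (tR s) = tLR s. Proof. reflexivity. Qed.
Lemma tR_tL (s : ty) : tR (tL s) = tLR s. Proof. reflexivity. Qed.
Lemma tL_tLR (s : ty) : tL (tLR s) = tR s. Proof. now destruct s as [[] []]. Qed.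
Lemma tR_tLR (s : ty) : tR (tLR s) = tL s. Proof. now destruct s as [[] []]. Qed.
#[local] Hint Rewrite tLL tRR tL_tR tR_tL tL_tLR tR_tLR : ty_rw.

Lemma ty_all (P : ty -> Prop) :
  (forall s, P s) <->
  P (false,false) /\ P (false,true) /\ P (true,false) /\ P (true,true).
Proof. split; [intuition | intros H [[] []]; apply H]. Qed.

Lemma ty_ex (P : ty -> Prop) :
  (exists s, P s) <->
  P (false,false) \/ P (false,true) \/ P (true,false) \/ P (true,true).
Proof. split; [intros ([[] []] & ?); tauto | firstorder]. Qed.

(** * Numbers of leaves and internal nodes of each type *)

Fixpoint mult (r : ty) (l : list ty) : nat :=
  match l with
  | [] => 0
  | s :: l' => (if ty_eqb s r then 1 else 0) + mult r l'
  end.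

Definition total (n : ty -> nat) : nat :=
  n (false,false) + n (false,true) + n (true,false) + n (true,true).

(* [n s] and [i s] stand for the numbers of leaves and of internal nodes of
   type [s] in a tree: every node except the root is a child of an internal
   node, and the root is internal unless the tree is a single leaf. *)
Definition fits (n i : ty -> nat) : Prop :=
  (forall s, n s + i s = (if ty_eqb s t00 then 1 else 0) + i (tL s) + i (tR s)) /\
  (1 <= i t00 \/ total i = 0).

Definition contains (n : ty -> nat) (l : list ty) : Prop :=
  forall r, mult r l <= n r.

(* What remains of a tree with internal nodes [i] when internal nodes of types
   [l] are removed by contracting cherries: it contains the root or is a leaf. *)
Definition removable (i : ty -> nat) (l : list ty) : Prop :=
  contains i l /\ (mult t00 l < i t00 \/ total i = length l).

Ltac pick_disjunct :=
  lazymatch goal with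
  | |- _ \/ _ => first [left; pick_disjunct | right; pick_disjunct]
  | |- _ /\ _ => split; [pick_disjunct | pick_disjunct]
  | |- _ => lia
  end.

Ltac split_at k l :=
  lazymatch l with
  | (?x, ?l') =>
      let H := fresh in
      destruct (Compare_dec.le_lt_dec k x) as [H | H];
      try (exfalso; lia); split_at k l'
  | _ => idtac
  end.

Ltac unfold_counts :=
  unfold removable, contains, fits in *; rewrite ?ty_ex, ?ty_all in *;
  unfold tLR, tL, tR, t00, total in *; cbn in *.

(** The goals are disjunctions of linear conditions on eight counts, and which disjunct holds varies
    with the counts. Comparing them with 1, 2, 3 and 4 separates the cases finely enough for [lia]
    to prove a single one. *)
Ltac by_thresholds l :=
  try pick_disjunct; split_at 1 l; try pick_disjunct; split_at 2 l;
  try pick_disjunct; split_at 3 l; try pick_disjunct; split_at 4 l; pick_disjunct.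

Ltac choose n i :=
  unfold_counts;
  generalize dependent (n (true,true)); intros n3;
  generalize dependent (n (true,false)); intros n2;
  generalize dependent (n (false,true)); intros n1;
  generalize dependent (n (false,false)); intros n0;
  generalize dependent (i (true,true)); intros i3;
  generalize dependent (i (true,false)); intros i2;
  generalize dependent (i (false,true)); intros i1;
  generalize dependent (i (false,false)); intros i0;
  intros; repeat match goal with H : _ /\ _ |- _ => destruct H end;
  repeat match goal with H : _ \/ _ |- _ => destruct H; try (exfalso; lia) end;
  by_thresholds (n0, (n1, (n2, (n3, (i0, (i1, (i2, (i3, tt)))))))).

(** * Cherries and small subtrees found by counting *)

(** With [fits_remove], this shows by induction that counts satisfying [fits] come from an actual
    tree. *)
Lemma fits_cherry (n i : ty -> nat) :
  fits n i -> 1 <= total i -> exists r, contains n [tL r; tR r] /\ removable i [r].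
Proof. intros H1 H2; choose n i. Qed.

(* Given leaves w of type [s] and b of type [tR s], some tree with the same leaves
   has a cherry avoiding both w and b, or a subtree (w c) b, b (w c), (b c) w or
   w (b c) with a third leaf c. *)
Lemma fits_right (s : ty) (n i : ty -> nat) :
  fits n i -> contains n [s; tR s] ->
  (exists r, contains n [s; tR s; tL r; tR r] /\ removable i [r]) \/
  (contains n [s; tR s; tLR s] /\ (removable i [s; tL s] \/ removable i [tLR s; tL s])) \/
  (contains n [s; tR s; tL s] /\ (removable i [tR s; tLR s] \/ removable i [tL s; tLR s])).
Proof. intros H1 H2; destruct s as [[] []]; choose n i. Qed.

(** The mirror image of [fits_right]: the subtrees are b (c w), (c w) b, w (c b) and (c b) w. *)
Lemma fits_left (s : ty) (n i : ty -> nat) :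
  fits n i -> contains n [s; tL s] ->
  (exists r, contains n [s; tL s; tL r; tR r] /\ removable i [r]) \/
  (contains n [s; tL s; tLR s] /\ (removable i [s; tR s] \/ removable i [tLR s; tR s])) \/
  (contains n [s; tL s; tR s] /\ (removable i [tL s; tLR s] \/ removable i [tR s; tLR s])).
Proof. intros H1 H2; destruct s as [[] []]; choose n i. Qed.

(** Cherries of types [s] and [tLR s] compete for leaves of the same two types. Either there are
    enough leaves for both at once, or a cherry of a type adjacent to both is available as a
    link. *)
Lemma fits_opposite (s : ty) (n i : ty -> nat) :
  fits n i -> contains n [tL s; tR s] -> removable i [s] -> removable i [tLR s] ->
  (contains n [tL s; tR s; tL s; tR s] /\ removable i [s; tLR s]) \/
  (contains n [s; tLR s] /\ removable i [tL s]) \/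
  (contains n [tLR s; s] /\ removable i [tR s]).
Proof. intros H1 H2 H3 H4; destruct s as [[] []]; choose n i. Qed.

(* The last two cases provide the leaf z of (x^2 z) y^2 and of (z x^2) y^2. *)
Lemma fits_exchange (n i : ty -> nat) :
  let l := [(true,false); (false,true); (false,false); (true,true)] in
  fits n i -> contains n l ->
  (exists r, contains n (l ++ [tL r; tR r]) /\ removable i [r]) \/
  (exists s, contains n (l ++ [tLR s]) /\ removable i [s; s; tL s; tR s]) \/
  (exists s, contains n (l ++ [s]) /\ removable i [s; tL s; tLR s; tR s]).
Proof. intros l H1 H2; subst l; choose n i. Qed.

(* The last two cases provide the leaf z of the terms in M7 and M8 with y = uv.
   At a root of odd type these identities move pairs in the opposite direction,
   whence [i'] in place of [i]. *)
Lemma fits_shift (n i n' i' : ty -> nat) :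
  let l := [(true,false); (false,true); (true,false); (false,true); (true,false); (false,true)] in
  fits n i -> contains n l -> fits n' i' ->
  (forall s, n' s + mult s l = n s + mult s (map tL l)) ->
  (exists r, contains n (l ++ [tL r; tR r]) /\ removable i [r] /\ removable i' [r]) \/
  (exists s, contains n (l ++ [tLR s]) /\
     removable (if xorb (fst s) (snd s) then i' else i) [s; s; s; tLR s; tL s; tR s]) \/
  (exists s, contains n (l ++ [s]) /\
     removable (if xorb (fst s) (snd s) then i' else i) [s; tLR s; tLR s; s; tL s; tR s]).
Proof.
  intros l H1 H2 H3 H4. subst l.
  (* Moving three pairs shifts each entry of [i] by one, down at 00 and 11 and up at 10 and 01. This
     eliminates [i'], so that the case analysis runs over [n] and [i] alone. *)
  assert (Hi : 1 <= i' (false,false) /\ i' (false,false) + 1 = i (false,false) /\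
     i' (true,true) + 1 = i (true,true) /\ i' (true,false) = i (true,false) + 1 /\
     i' (false,true) = i (false,true) + 1).
  { unfold_counts; lia. }
  clear H3 H4; unfold_counts.
  destruct Hi as (E & E0 & E3 & E2 & E1).
  rewrite ?E2, ?E1.
  assert (F0 : i' (false,false) = i (false,false) - 1) by lia.
  assert (F3 : i' (true,true) = i (true,true) - 1) by lia.
  rewrite F0, F3 in *; clear F0 F3.
  choose n i.
Qed.

(** * Contracting and expanding cherries at the level of counts *)

Lemma mult_app (r : ty) (l l' : list ty) : mult r (l ++ l') = mult r l + mult r l'.
Proof. induction l; cbn; lia. Qed.

Lemma mult_perm (r : ty) (l l' : list ty) : Permutation l l' -> mult r l = mult r l'.
Proof. induction 1; cbn; lia. Qed.

Lemma mult_tL (r : ty) (l : list ty) : mult r (map tL l) = mult (tL r) l.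
Proof.
  induction l as [|s l IH]; cbn; [easy|]; rewrite IH.
  now destruct s as [[] []], r as [[] []].
Qed.

Lemma mult_tR (r : ty) (l : list ty) : mult r (map tR l) = mult (tR r) l.
Proof.
  induction l as [|s l IH]; cbn; [easy|]; rewrite IH.
  now destruct s as [[] []], r as [[] []].
Qed.

Lemma total_mult (l : list ty) : total (fun r => mult r l) = length l.
Proof.
  induction l as [|s l IH]; [easy|]; cbn [length]; rewrite <- IH.
  unfold total; destruct s as [[] []]; cbn; lia.
Qed.

(** Contraction deletes the children, of types [map tL l] and [map tR l], and turns the parents [l]
    into leaves. The balance is written with sums because subtraction on [nat] truncates. *)
Lemma fits_remove (n i n' : ty -> nat) (l : list ty) :
  fits n i -> removable i l ->
  (forall r, n' r + mult r (map tL l) + mult r (map tR l) = n r + mult r l) ->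
  fits n' (fun r => i r - mult r l).
Proof.
  intros [H1 H2] [H3 H4] H5; split.
  - intros s; specialize (H1 s); specialize (H5 s).
    rewrite mult_tL, mult_tR in H5.
    pose proof (H3 s); pose proof (H3 (tL s)); pose proof (H3 (tR s)); lia.
  - destruct H4 as [H4 | H4]; [left; lia | right].
    rewrite <- (total_mult l) in H4; unfold contains in H3.
    rewrite ty_all in H3; unfold total in *; lia.
Qed.

Definition cnts {A : Type} (S : list (A * ty)) : ty -> nat := fun r => mult r (map snd S).

Definition feasible {A : Type} (S : list (A * ty)) : Prop := exists i, fits (cnts S) i.

Lemma cnts_perm {A : Type} (S S' : list (A * ty)) (r : ty) :
  Permutation S S' -> cnts S r = cnts S' r.
Proof. intros H; apply mult_perm, Permutation_map, H. Qed.

Lemma total_cnts {A : Type} (S : list (A * ty)) : total (cnts S) = length S.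
Proof. unfold cnts; rewrite total_mult; apply length_map. Qed.

Lemma fits_ext (n n' i : ty -> nat) : (forall s, n s = n' s) -> fits n i -> fits n' i.
Proof. intros H [H1 H2]; split; [intros s; now rewrite <- H | easy]. Qed.

Lemma feasible_remove {A B : Type} (S : list (A * ty)) (S' : list (B * ty))
    (i : ty -> nat) (l : list ty) :
  fits (cnts S) i -> removable i l ->
  (forall r, cnts S' r + mult r (map tL l) + mult r (map tR l) = cnts S r + mult r l) ->
  feasible S'.
Proof. intros H1 H2 H3; eexists; exact (fits_remove _ _ _ _ H1 H2 H3). Qed.

Lemma feasible_ext {A B : Type} (S : list (A * ty)) (S' : list (B * ty)) :
  (forall r, cnts S r = cnts S' r) -> feasible S -> feasible S'.
Proof. intros H [i Hi]; exists i; exact (fits_ext _ _ _ H Hi). Qed.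

Lemma fits_expand {A : Type} (a b c : A) (s : ty) (R : list (A * ty)) (i : ty -> nat) :
  fits (cnts ((c, s) :: R)) i ->
  fits (cnts ((a, tL s) :: (b, tR s) :: R)) (fun r => i r + mult r [s]) /\
  removable (fun r => i r + mult r [s]) [s].
Proof.
  intros Hi; assert (H1 : fits (cnts ((a, tL s) :: (b, tR s) :: R)) (fun r => i r + mult r [s])).
  { destruct Hi as [H1 H2]; split.
    - intros r; specialize (H1 r); revert H1; unfold cnts; cbn.
      destruct s as [[] []], r as [[] []]; cbn; lia.
    - left; rewrite ty_all in H1; revert H1 H2; unfold total, cnts, tL, tR, t00.
      destruct s as [[] []]; cbn; lia. }
  split; [exact H1 |]; destruct Hi as [H2 H3]; split; [intros r; lia |].
  rewrite ty_all in H2; revert H2 H3; unfold total, cnts, tL, tR, t00.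
  destruct s as [[] []]; cbn; lia.
Qed.

(** The balance equations form a linear system for [i] with matrix A - 1, where A is the adjacency
    matrix of the 4-cycle of types. Its eigenvalues 2, 0, 0, -2 avoid 1, so the system is
    nonsingular. *)
Lemma fits_unique (n i j : ty -> nat) : fits n i -> fits n j -> forall s, i s = j s.
Proof. intros [H1 _] [H2 _]; rewrite ty_all in *; unfold tL, tR in *; cbn in *; lia. Qed.

Lemma removable_ext (i j : ty -> nat) (l : list ty) :
  (forall s, i s = j s) -> removable i l -> removable j l.
Proof.
  intros H [H1 H2]; split; [intros r; rewrite <- H; apply H1 |].
  unfold total in *; rewrite <- !H; exact H2.
Qed.

Lemma contains_cons {A : Type} (a : A) (s : ty) (l : list ty) (R : list (A * ty)) :
  contains (cnts ((a, s) :: R)) (s :: l) -> contains (cnts R) l.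
Proof. intros H r; specialize (H r); unfold cnts in *; cbn in H; lia. Qed.

Lemma contains_pick {A : Type} (s : ty) (l : list ty) (R : list (A * ty)) :
  contains (cnts R) (s :: l) ->
  exists a R', Permutation R ((a, s) :: R') /\ contains (cnts R') l.
Proof.
  intros H.
  assert (Hp : exists a R', Permutation R ((a, s) :: R')).
  { assert (H1 : 1 <= mult s (map snd R)).
    { specialize (H s); unfold cnts in H; cbn in H.
      replace (ty_eqb s s) with true in H by now destruct s as [[] []].
      lia. }
    clear H; induction R as [|[b r] R IH]; cbn in H1; [lia|].
    destruct (ty_eqb r s) eqn:E.
    - apply ty_eqb_eq in E; subst r; now exists b, R.
    - destruct IH as (a & R' & HR); [lia|].
      exists a, ((b, r) :: R'); rewrite HR; apply perm_swap. }
  destruct Hp as (a & R' & HR); exists a, R'; split; [easy|].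
  apply (contains_cons a s); intros r; rewrite <- (cnts_perm _ _ r HR); apply H.
Qed.

Lemma perm_bring {A : Type} (a c : A) (l l' : list A) :
  Permutation l (a :: l') -> Permutation (c :: l) (a :: c :: l').
Proof. intros H; rewrite H; apply perm_swap. Qed.

(** The cast of [eq_refl] tests convertibility, so types computed in different ways still match; the
    [match goal] only supplies backtracking to later entries. *)
Ltac bring a l :=
  lazymatch l with
  | ?c :: ?l' =>
      match goal with
      | _ => let e := constr:(eq_refl a : a = c) in constr:(Permutation_refl l)
      | _ => let p := bring a l' in constr:(perm_bring a c _ _ p)
      end
  end.

Ltac perm :=
  lazymatch goal with
  | |- Permutation ?l ?l => reflexivity
  | |- Permutation (?a :: ?l) ?r =>
      let p := bring a r in
      apply Permutation_sym; apply (perm_trans p); apply perm_skip;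
      apply Permutation_sym; perm
  end.

Lemma perm_cons_inv2 {A : Type} (a b : A) (l l' : list A) :
  Permutation (a :: l) (b :: l') ->
  (a = b /\ Permutation l l') \/
  exists m, Permutation l (b :: m) /\ Permutation l' (a :: m).
Proof.
  intros H.
  assert (Hb : In b (a :: l)) by (apply Permutation_in with (b :: l'); [now symmetry | now left]).
  destruct Hb as [-> | Hb].
  - left; split; [easy | exact (Permutation_cons_inv H)].
  - right; apply in_split in Hb as (l1 & l2 & ->); exists (l1 ++ l2); split.
    + symmetry; apply Permutation_middle.
    + apply (Permutation_cons_inv (a := b)); rewrite <- H.
      rewrite <- Permutation_middle; apply perm_swap.
Qed.

(* [merges op S g]: some tree with the multiset [S] of typed leaves has value [g];
   it is built by repeatedly contracting a cherry. *)
Inductive merges {T : Type} (op : T -> T -> T) : list (T * ty) -> T -> Prop :=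
| merges_leaf g : merges op [(g, t00)] g
| merges_node a b s R S g :
    Permutation S ((a, tL s) :: (b, tR s) :: R) ->
    merges op ((op a b, s) :: R) g -> merges op S g.

(** * Values of trees built from a multiset of typed leaves *)

Section Merging.

Context {T : Type} (op : T -> T -> T).

Lemma merges_perm (S S' : list (T * ty)) (g : T) :
  Permutation S S' -> merges op S g -> merges op S' g.
Proof.
  intros HP H; destruct H as [g | a b s R S g HS H].
  - rewrite (Permutation_length_1_inv HP); constructor.
  - apply (merges_node op a b s R); [now rewrite <- HP | easy].
Qed.

Lemma merges_feasible (S : list (T * ty)) (g : T) : merges op S g -> feasible S.
Proof.
  induction 1 as [g | a b s R S g HS H [i Hi]].
  - exists (fun _ => 0); split; [intros [[] []]; reflexivity | now right].
  - destruct (fits_expand a b _ s R i Hi) as [H' _].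
    exists (fun r => i r + mult r [s]); revert H'; apply fits_ext.
    intros r; symmetry; exact (cnts_perm _ _ r HS).
Qed.

Lemma feasible_cases (S : list (T * ty)) :
  feasible S ->
  (exists g, S = [(g, t00)]) \/
  exists a b s R, Permutation S ((a, tL s) :: (b, tR s) :: R) /\
    forall c : T, feasible ((c, s) :: R).
Proof.
  intros [i Hi].
  destruct (PeanoNat.Nat.eq_dec (total i) 0) as [E | E].
  - left; destruct Hi as [Hi _].
    assert (HS : length S = 1 /\ cnts S t00 = 1).
    { rewrite <- total_cnts; unfold total in *; rewrite ty_all in Hi.
      unfold tL, tR, t00 in *; cbn in *; lia. }
    destruct S as [|[g r] [|]]; cbn in HS; try lia.
    exists g; repeat f_equal; apply ty_eqb_eq.
    destruct HS as [_ HS]; unfold cnts in HS; cbn in HS.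
    now destruct (ty_eqb r t00).
  - right; destruct (fits_cherry (cnts S) i) as (s & H1 & H2); [easy | lia |].
    apply contains_pick in H1 as (a & S1 & HS1 & H1).
    apply contains_pick in H1 as (b & R & HR & _).
    rewrite HR in HS1; exists a, b, s, R; split; [easy|].
    intros c; apply (feasible_remove S _ i [s]); [easy..|].
    intros r; rewrite (cnts_perm _ _ r HS1); unfold cnts; cbn; lia.
Qed.

Lemma feasible_merges (S : list (T * ty)) : feasible S -> exists g, merges op S g.
Proof.
  remember (length S) as n eqn:En; revert S En.
  induction n as [n IH] using (well_founded_induction Wf_nat.lt_wf); intros S -> HF.
  destruct (feasible_cases S HF) as [[g ->] | (a & b & s & R & HS & HR)].
  - exists g; constructor.
  - destruct (IH (length ((op a b, s) :: R))) with (S := (op a b, s) :: R) as [g Hg];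
      [rewrite (Permutation_length HS); cbn; lia | easy | apply HR |].
    exists g; exact (merges_node op a b s R S g HS Hg).
Qed.

Fixpoint leaves (v : nat -> T) (e : term) (s : ty) : list (T * ty) :=
  match e with
  | Var k => [(v k, s)]
  | Op e1 e2 => leaves v e1 (tL s) ++ leaves v e2 (tR s)
  end.

Lemma merges_leaves (v : nat -> T) (e : term) (s : ty) (R : list (T * ty)) (g : T) :
  merges op ((eval op v e, s) :: R) g -> merges op (leaves v e s ++ R) g.
Proof.
  revert s R g; induction e as [k | e1 IH1 e2 IH2]; intros s R g H; [exact H|].
  cbn; rewrite <- app_assoc; apply IH1.
  apply (merges_perm (leaves v e2 (tR s) ++ (eval op v e1, tL s) :: R)).
  { symmetry; apply Permutation_middle. }
  apply IH2, (merges_node op (eval op v e1) (eval op v e2) s R); [apply perm_swap | exact H].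
Qed.
End Merging.

Ltac remove x l :=
  lazymatch l with
  | x :: ?l' => l'
  | ?y :: ?l' => let r := remove x l' in constr:(y :: r)
  end.

Ltac typeL s :=
  lazymatch s with tL ?r => r | tR ?r => constr:(tLR r) | tLR ?r => constr:(tR r) | _ => constr:(tL s) end.
Ltac typeR s :=
  lazymatch s with tR ?r => r | tL ?r => constr:(tLR r) | tLR ?r => constr:(tL r) | _ => constr:(tR s) end.

(* Reduces the goal [merges op S g] by merging [a] and [b] into a node of type [s]. *)
Ltac node a b s :=
  lazymatch goal with
  | |- merges ?op ?S _ =>
      let sa := typeL s in let sb := typeR s in
      let pa := constr:((a, sa)) in let pb := constr:((b, sb)) in
      let l1 := remove pa S in let l2 := remove pb l1 in
      apply (merges_node op a b s l2 S); [autorewrite with ty_rw; perm |]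
  end.

Ltac by_merges H := eapply merges_perm; [| exact H]; perm.

Ltac count_concrete HR :=
  let q := fresh in intros q; unfold cnts; cbn [map snd mult];
  rewrite (mult_perm q _ _ (Permutation_map snd HR));
  destruct q as [[] []]; cbn; lia.

Ltac count_types HR s := destruct s as [[] []]; count_concrete HR.

Ltac retail HR H :=
  eapply merges_perm in H; [| repeat apply perm_skip; exact HR].

(** Here [n] and [n'] arise from one multiset by contracting a cherry of type [s] and of type [r].
    The internal nodes before contraction are determined by that multiset, so a node of type [r] is
    still present in [i]. *)
Lemma fits_two (s r : ty) (n n' i j : ty -> nat) :
  fits n i -> fits n' j -> s <> r ->
  (forall q, n q + mult q [r] + mult q [tL s; tR s] = n' q + mult q [s] + mult q [tL r; tR r]) ->
  removable i [r].
Proof.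
  intros H1 H2 H3 H4.
  destruct s as [[] []], r as [[] []]; try congruence; clear H3; unfold_counts; lia.
Qed.

(** * M1-M6 make the value depend only on the typed leaves *)

Section Uniqueness.

Context {T : Type} (op : T -> T -> T).

Hypothesis m1 : forall x y z t, op (op x y) (op z t) = op (op x z) (op y t).
Hypothesis m2 : forall x y z t, op (op x y) (op z t) = op (op t y) (op z x).
Hypothesis m3 : forall x y z t, op (op (op x y) z) t = op (op (op x t) z) y.
Hypothesis m4 : forall x y z t, op (op x (op y z)) t = op (op x (op t z)) y.
Hypothesis m5 : forall x y z t, op x (op (op y z) t) = op z (op (op y x) t).
Hypothesis m6 : forall x y z t, op x (op y (op z t)) = op z (op y (op x t)).

Definition unique_upto (n : nat) : Prop :=
  forall S g g', length S <= n -> merges op S g -> merges op S g' -> g = g'.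

(** A diamond argument: [S3] has some value because it is feasible, and this value passes to both
    [S1] and [S2], which are short enough for uniqueness. *)
Lemma join (n : nat) (S1 S2 S3 : list (T * ty)) (g1 g2 : T) :
  unique_upto n -> length S1 <= n -> length S2 <= n -> feasible S3 ->
  (forall h, merges op S3 h -> merges op S1 h) ->
  (forall h, merges op S3 h -> merges op S2 h) ->
  merges op S1 g1 -> merges op S2 g2 -> g1 = g2.
Proof.
  intros U L1 L2 F H1 H2 M1 M2.
  destruct (feasible_merges op S3 F) as [h Hh].
  transitivity h; [apply (U S1) | symmetry; apply (U S2)]; auto.
Qed.

(** [S] has a whole subtree with four leaves contracted. What remains is to reach it from either
    side, from the second one by means of an identity. *)
Ltac contract S :=
  lazymatch goal with
  | U : unique_upto ?n, HL : _ <= ?n, HR : Permutation _ (_ :: _), Hi : fits _ _,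
    Hr : removable _ ?l, H1 : merges op ((_, ?s) :: _) ?g, H2 : merges op _ ?g' |- ?g = ?g' =>
      retail HR H1; retail HR H2; rewrite (Permutation_length HR) in HL; cbn in HL;
      eapply (join n _ _ S); [exact U | | | | | | exact H1 | exact H2];
      [cbn; lia | cbn; lia | apply (feasible_remove _ _ _ l Hi Hr); count_types HR s
      | intros h Hh | intros h Hh]
  end.

(** If some cherry avoids the leaves concerned, contracting it leaves a multiset short enough to
    carry out the swap by induction. Otherwise [a], [b], [b'] and a further leaf form a subtree in
    which the swap is an instance of [m3], [m5], [m2] or [m1]. *)
Lemma swap_right (n : nat) (s : ty) (a b b' : T) (R : list (T * ty)) (g g' : T) :
  unique_upto n -> length R + 2 <= n ->
  merges op ((op a b, s) :: (b', tR s) :: R) g ->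
  merges op ((op a b', s) :: (b, tR s) :: R) g' -> g = g'.
Proof.
  intros U HL H1 H2; destruct (merges_feasible op _ _ H1) as [i Hi].
  assert (Hc0 : contains (cnts ((op a b, s) :: (b', tR s) :: R)) [s; tR s])
    by (intros q; unfold cnts; cbn; lia).
  destruct (fits_right s _ i Hi Hc0) as [(r & Hc & Hr) | [[Hc [Hr | Hr]] | [Hc [Hr | Hr]]]];
    do 2 apply contains_cons in Hc; apply contains_pick in Hc as (c & R1 & HR & Hc).
  - apply contains_pick in Hc as (d & R2 & HR' & _); rewrite HR' in HR; clear HR' R1 Hc0.
    rewrite (Permutation_length HR) in HL; cbn in HL.
    retail HR H1; retail HR H2.
    assert (F : forall x y, feasible ((op c d, r) :: (op a x, s) :: (y : T, tR s) :: R2)).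
    { intros x y; apply (feasible_remove _ _ i [r] Hi Hr). count_types HR s. }
    destruct (feasible_merges op _ (F b b')) as [h Hh].
    destruct (feasible_merges op _ (F b' b)) as [h' Hh'].
    (* Both [h] and [h'] are values of one multiset in which [c] and [d] are merged and [a], [b],
       [b'] are still separate. *)
    transitivity h; [| transitivity h'].
    + eapply U; [| exact H1 |]; [cbn; lia |]. node c d r. by_merges Hh.
    + apply (U ((op c d, r) :: (a, tL s) :: (b, tR s) :: (b', tR s) :: R2)); [cbn; lia | |].
      * node a b s. by_merges Hh.
      * node a b' s. by_merges Hh'.
    + eapply U; [| | exact H2]; [cbn; lia |]. node c d r. by_merges Hh'.
  - contract ((op (op (op a b) c) b', s) :: R1).
    + node (op a b) c (tL s). node (op (op a b) c) b' s. by_merges Hh.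
    + node (op a b') c (tL s). node (op (op a b') c) b s. rewrite m3. by_merges Hh.
  - contract ((op b' (op (op a b) c), tLR s) :: R1).
    + node (op a b) c (tL s). node b' (op (op a b) c) (tLR s). by_merges Hh.
    + node (op a b') c (tL s). node b (op (op a b') c) (tLR s). rewrite m5. by_merges Hh.
  - contract ((op (op b' c) (op a b), tR s) :: R1).
    + node b' c (tLR s). node (op b' c) (op a b) (tR s). by_merges Hh.
    + node b c (tLR s). node (op b c) (op a b') (tR s). rewrite m2. by_merges Hh.
  - contract ((op (op a b) (op b' c), tL s) :: R1).
    + node b' c (tLR s). node (op a b) (op b' c) (tL s). by_merges Hh.
    + node b c (tLR s). node (op a b') (op b c) (tL s). rewrite m1. by_merges Hh.
Qed.

Lemma swap_left (n : nat) (s : ty) (a a' b : T) (R : list (T * ty)) (g g' : T) :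
  unique_upto n -> length R + 2 <= n ->
  merges op ((op a b, s) :: (a', tL s) :: R) g ->
  merges op ((op a' b, s) :: (a, tL s) :: R) g' -> g = g'.
Proof.
  intros U HL H1 H2; destruct (merges_feasible op _ _ H1) as [i Hi].
  assert (Hc0 : contains (cnts ((op a b, s) :: (a', tL s) :: R)) [s; tL s])
    by (intros q; unfold cnts; cbn; lia).
  destruct (fits_left s _ i Hi Hc0) as [(r & Hc & Hr) | [[Hc [Hr | Hr]] | [Hc [Hr | Hr]]]];
    do 2 apply contains_cons in Hc; apply contains_pick in Hc as (c & R1 & HR & Hc).
  - apply contains_pick in Hc as (d & R2 & HR' & _); rewrite HR' in HR; clear HR' R1 Hc0.
    rewrite (Permutation_length HR) in HL; cbn in HL.
    retail HR H1; retail HR H2.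
    assert (F : forall x y, feasible ((op c d, r) :: (op x b, s) :: (y : T, tL s) :: R2)).
    { intros x y; apply (feasible_remove _ _ i [r] Hi Hr). count_types HR s. }
    destruct (feasible_merges op _ (F a a')) as [h Hh].
    destruct (feasible_merges op _ (F a' a)) as [h' Hh'].
    transitivity h; [| transitivity h'].
    + eapply U; [| exact H1 |]; [cbn; lia |]. node c d r. by_merges Hh.
    + apply (U ((op c d, r) :: (a, tL s) :: (a', tL s) :: (b, tR s) :: R2)); [cbn; lia | |].
      * node a b s. by_merges Hh.
      * node a' b s. by_merges Hh'.
    + eapply U; [| | exact H2]; [cbn; lia |]. node c d r. by_merges Hh'.
  - contract ((op a' (op c (op a b)), s) :: R1).
    + node c (op a b) (tR s). node a' (op c (op a b)) s. by_merges Hh.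
    + node c (op a' b) (tR s). node a (op c (op a' b)) s. rewrite m6. by_merges Hh.
  - contract ((op (op c (op a b)) a', tLR s) :: R1).
    + node c (op a b) (tR s). node (op c (op a b)) a' (tLR s). by_merges Hh.
    + node c (op a' b) (tR s). node (op c (op a' b)) a (tLR s). rewrite m4. by_merges Hh.
  - contract ((op (op a b) (op c a'), tL s) :: R1).
    + node c a' (tLR s). node (op a b) (op c a') (tL s). by_merges Hh.
    + node c a (tLR s). node (op a' b) (op c a) (tL s). rewrite m2. by_merges Hh.
  - contract ((op (op c a') (op a b), tR s) :: R1).
    + node c a' (tLR s). node (op c a') (op a b) (tR s). by_merges Hh.
    + node c a (tLR s). node (op c a) (op a' b) (tR s). rewrite m1. by_merges Hh.
Qed.

Lemma cherry_other_type (A : Type) (a b : A) (s r : ty) (l l' : list (A * ty)) :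
  s <> r -> Permutation ((a, s) :: l) ((b, r) :: l') ->
  exists m, Permutation l ((b, r) :: m) /\ Permutation l' ((a, s) :: m).
Proof.
  intros Hsr H; destruct (perm_cons_inv2 _ _ _ _ H) as [[E _] | Hm]; [congruence | exact Hm].
Qed.

Lemma unique_right (n : nat) (s : ty) (a b d : T) (R R' : list (T * ty)) (g g' : T) :
  unique_upto n -> length R + 1 <= n ->
  Permutation ((b, tR s) :: R) ((d, tR s) :: R') ->
  merges op ((op a b, s) :: R) g -> merges op ((op a d, s) :: R') g' -> g = g'.
Proof.
  intros U HL HP H1 H2.
  destruct (perm_cons_inv2 _ _ _ _ HP) as [[[= <-] HR] | (m & HR & HR')].
  - apply (U ((op a b, s) :: R)); [cbn; lia | easy |].
    retail (Permutation_sym HR) H2; exact H2.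
  - retail HR H1; retail HR' H2; rewrite (Permutation_length HR) in HL; cbn in HL.
    apply (swap_right n s a b d m); [easy | lia | easy..].
Qed.

(** The cherry of [c] and [b] is an intermediate stage, so that only one leaf changes at a time. *)
Lemma unique_same_type (n : nat) (s : ty) (a b c d : T) (R R' : list (T * ty)) (g g' : T) :
  unique_upto n -> length R + 1 <= n ->
  Permutation ((a, tL s) :: (b, tR s) :: R) ((c, tL s) :: (d, tR s) :: R') ->
  merges op ((op a b, s) :: R) g -> merges op ((op c d, s) :: R') g' -> g = g'.
Proof.
  intros U HL HP H1 H2.
  assert (Hs : tR s <> tL s) by now destruct s as [[] []].
  destruct (perm_cons_inv2 _ _ _ _ HP) as [[[= <-] HR] | (m & HR & HR')].
  - exact (unique_right n s a b d R R' g g' U HL HR H1 H2).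
  - apply cherry_other_type in HR as (m' & HR & Hm); [| easy].
    rewrite Hm in HR'; retail HR H1; rewrite (Permutation_length HR) in HL; cbn in HL.
    assert (F : feasible ((op c b, s) :: (a, tL s) :: m')).
    { refine (feasible_ext _ _ _ (merges_feasible op _ _ H1)); intros q; reflexivity. }
    destruct (feasible_merges op _ F) as [h Hh].
    transitivity h.
    + apply (swap_left n s a c b m'); [easy | lia | easy..].
    + apply (unique_right n s c b d ((a, tL s) :: m') R'); [easy | cbn; lia | | easy..].
      rewrite HR'; apply perm_swap.
Qed.

(** The two cherries have no leaf type in common, hence are disjoint and can both be contracted. *)
Lemma unique_adjacent (n : nat) (s r : ty) (a b c d : T) (R R' : list (T * ty)) (g g' : T) :
  unique_upto n -> length R + 1 <= n -> r = tL s \/ r = tR s ->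
  Permutation ((a, tL s) :: (b, tR s) :: R) ((c, tL r) :: (d, tR r) :: R') ->
  merges op ((op a b, s) :: R) g -> merges op ((op c d, r) :: R') g' -> g = g'.
Proof.
  intros U HL Hr HP H1 H2.
  assert (H : tL s <> tL r /\ tL s <> tR r /\ tR s <> tL r /\ tR s <> tR r)
    by (destruct s as [[] []], Hr as [-> | ->]; repeat split; discriminate).
  destruct H as (N1 & N2 & N3 & N4).
  apply cherry_other_type in HP as (m1' & HP & HR'); [| easy].
  apply cherry_other_type in HP as (m2' & HR & HP); [| easy].
  rewrite HP in HR'.
  apply cherry_other_type in HR' as (m3' & HR' & Hm); [| congruence].
  apply cherry_other_type in Hm as (m & Hm & Hm'); [| congruence].
  rewrite Hm' in HR'.
  assert (HR2 : Permutation R ((c, tL r) :: (d, tR r) :: m)).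
  { rewrite HR; apply perm_skip.  exact Hm.  }
  retail HR2 H1; retail HR' H2; rewrite (Permutation_length HR2) in HL; cbn in HL.
  destruct (merges_feasible op _ _ H1) as [i Hi], (merges_feasible op _ _ H2) as [j Hj].
  eapply (join n _ _ ((op a b, s) :: (op c d, r) :: m) g g'); [exact U | | | | | | exact H1 | exact H2];
    [cbn; lia | cbn; lia | | |].
  - apply (feasible_remove _ _ i [r] Hi).
    + apply (fits_two s r _ _ i j Hi Hj); [intros ->; intuition congruence |].
      intros q; unfold cnts; cbn; lia.
    + intros q; unfold cnts; cbn; lia.
  - intros h Hh. node c d r. by_merges Hh.
  - intros h Hh. node a b s. by_merges Hh.
Qed.

Lemma unique_any_type (n : nat) (s r : ty) (a b c d : T) (R R' : list (T * ty)) (g g' : T) :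
  unique_upto n -> length R + 1 <= n ->
  Permutation ((a, tL s) :: (b, tR s) :: R) ((c, tL r) :: (d, tR r) :: R') ->
  merges op ((op a b, s) :: R) g -> merges op ((op c d, r) :: R') g' -> g = g'.
Proof.
  intros U HL HP H1 H2.
  assert (Hr : r = s \/ (r = tL s \/ r = tR s) \/ r = tLR s)
    by (destruct s as [[] []], r as [[] []]; cbn; auto).
  destruct Hr as [-> | [Hr | ->]].
  - exact (unique_same_type n s a b c d R R' g g' U HL HP H1 H2).
  - exact (unique_adjacent n s r a b c d R R' g g' U HL Hr HP H1 H2).
  - pose proof (Permutation_length HP) as HL'; cbn in HL'.
    destruct (merges_feasible op _ _ H1) as [i Hi], (merges_feasible op _ _ H2) as [j Hj].
    rewrite tL_tLR, tR_tLR in HP.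
    destruct (fits_expand a b _ s R i Hi) as [Hi' Hs].
    destruct (fits_expand c d _ (tLR s) R' j Hj) as [Hj' Hs'].
    assert (Hj'' : fits (cnts ((a, tL s) :: (b, tR s) :: R)) (fun q => j q + mult q [tLR s])).
    { revert Hj'; apply fits_ext; intros q; symmetry; apply cnts_perm.
      now rewrite tL_tLR, tR_tLR. }
    (* Both trees have the same leaves, hence equally many internal nodes of each type, so both
       cherries are removable with respect to one count. *)
    apply (removable_ext _ _ _ (fits_unique _ _ _ Hj'' Hi')) in Hs'.
    assert (Hc0 : contains (cnts ((a, tL s) :: (b, tR s) :: R)) [tL s; tR s])
      by (intros q; unfold cnts; cbn; lia).
    destruct (fits_opposite s _ _ Hi' Hc0 Hs Hs') as [[Hc Hr] | H].
    + apply contains_pick in Hc as (p & S1 & HS & Hc).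
      apply contains_pick in Hc as (q & S2 & HS2 & Hc); rewrite HS2 in HS.
      apply contains_pick in Hc as (p' & S3 & HS3 & Hc); rewrite HS3 in HS.
      apply contains_pick in Hc as (q' & Z & HZ & _); rewrite HZ in HS.
      clear S1 S2 S3 HS2 HS3 HZ.
      (* A tree with disjoint cherries at [s] and [tLR s] is compared with each side through the
         cherry of equal type. *)
      destruct (feasible_merges op ((op p q, s) :: (op q' p', tLR s) :: Z)) as [h Hh].
      { apply (feasible_remove _ _ _ _ Hi' Hr); intros r.
        rewrite (cnts_perm _ _ r HS); unfold cnts; cbn [map snd mult].
        destruct s as [[] []], r as [[] []]; cbn; lia. }
      transitivity h.
      * apply (unique_same_type n s a b p q R ((p', tL s) :: (q', tR s) :: Z)); [easy..|].
        node q' p' (tLR s). by_merges Hh.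
      * apply (unique_same_type n (tLR s) q' p' c d ((p, tL s) :: (q, tR s) :: Z) R');
          [easy | | | | easy].
        -- apply Permutation_length in HS; cbn in *; lia.
        -- autorewrite with ty_rw; rewrite <- HP, HS; perm.
        -- node p q s. by_merges Hh.
    + assert (Hr : exists r, (r = tL s /\ tLR s = tR r \/ r = tR s /\ tLR s = tL r) /\
         contains (cnts ((a, tL s) :: (b, tR s) :: R)) [tL r; tR r] /\
         removable (fun q => i q + mult q [s]) [r]).
      { destruct H as [[Hc Hr] | [Hc Hr]]; [exists (tL s) | exists (tR s)];
          autorewrite with ty_rw; auto. }
      clear H; destruct Hr as (r & E & Hc & Hr).
      apply contains_pick in Hc as (p & S1 & HS & Hc).
      apply contains_pick in Hc as (q & Z & HZ & _); rewrite HZ in HS; clear S1 HZ.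
      (* The type [r] is adjacent to both [s] and [tLR s], so this tree links the two sides. *)
      destruct (feasible_merges op ((op p q, r) :: Z)) as [h Hh].
      { apply (feasible_remove _ _ _ _ Hi' Hr); intros e.
        rewrite (cnts_perm _ _ e HS); unfold cnts; cbn; lia. }
      transitivity h.
      * apply (unique_adjacent n s r a b p q R Z); [easy | easy | intuition | easy..].
      * apply (unique_adjacent n r (tLR s) p q c d Z R');
          [easy | | intuition | | easy..].
        -- apply Permutation_length in HS; cbn in *; lia.
        -- rewrite tL_tLR, tR_tLR, <- HP; now symmetry.
Qed.

Lemma unique_value (S : list (T * ty)) (g g' : T) :
  merges op S g -> merges op S g' -> g = g'.
Proof.
  assert (U : forall n, unique_upto n).
  { induction n as [|n IH]; intros S0 h h' HL H1 H2.
    - destruct H1 as [| a b s R S0 h HS _]; [cbn in HL; lia |].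
      apply Permutation_length in HS; cbn in *; lia.
    - destruct H1 as [h | a b s R S0 h HS H1]; inversion H2 as [k | c d r R' S1 k HS' H3]; subst.
      + reflexivity.
      + apply Permutation_length in HS'; discriminate.
      + apply Permutation_length in HS; discriminate.
      + apply (unique_any_type n s r a b c d R R'); [easy | | | easy..].
        * apply Permutation_length in HS; cbn in HS; lia.
        * now rewrite <- HS. }
  apply (U (length S)); constructor.
Qed.
End Uniqueness.

(** * Moving pairs of leaves by M7 and M8 *)

(** Under the operation al a + be b with signs al, be, a pair at 10, 01 has coefficient al + be and
    a pair at 00, 11 has 1 + al be. These agree unless al = be = -1, so the three operations cannot
    distinguish the two kinds of pairs. *)
Definition odd_pairs {A : Type} (X : list A) : list (A * ty) :=
  flat_map (fun a => [(a, (true, false)); (a, (false, true))]) X.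

Definition even_pairs {A : Type} (X : list A) : list (A * ty) :=
  flat_map (fun a => [(a, (false, false)); (a, (true, true))]) X.

Lemma cnts_odd_pairs {A : Type} (X : list A) (r : ty) :
  cnts (odd_pairs X) r = if xorb (fst r) (snd r) then length X else 0.
Proof.
  unfold cnts; induction X as [|a X IH]; cbn; [now destruct xorb|].
  unfold odd_pairs in IH; rewrite IH; now destruct r as [[] []].
Qed.

Lemma cnts_even_pairs {A : Type} (X : list A) (r : ty) :
  cnts (even_pairs X) r = if xorb (fst r) (snd r) then 0 else length X.
Proof.
  unfold cnts; induction X as [|a X IH]; cbn; [now destruct xorb|].
  unfold even_pairs in IH; rewrite IH; now destruct r as [[] []].
Qed.

Lemma cnts_app {A : Type} (S S' : list (A * ty)) (r : ty) :
  cnts (S ++ S') r = cnts S r + cnts S' r.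
Proof. unfold cnts; rewrite map_app; apply mult_app. Qed.

(** The vector that is 1 at 00, 11 and -1 at 10, 01 is an eigenvector of the balance system with
    eigenvalue -3. Moving [k] pairs thus changes each entry of [i] by k/3, which makes [k] a
    multiple of 3 and every stage of three pairs feasible. *)
Lemma fits_between (k : nat) (c n n' i i' : ty -> nat) :
  fits n i -> fits n' i' -> 1 <= k ->
  (forall r, n r = (if xorb (fst r) (snd r) then k else 0) + c r) ->
  (forall r, n' r = (if xorb (fst r) (snd r) then 0 else k) + c r) ->
  3 <= k /\
  fits (fun r => (if xorb (fst r) (snd r) then k - 3 else 3) + c r)
       (fun r => if xorb (fst r) (snd r) then i r + 1 else i r - 1).
Proof.
  intros H1 H2 H3 H4 H5; unfold_counts.
  repeat match goal with H : _ /\ _ |- _ => destruct H end.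
  repeat split; lia.
Qed.

Section Exchange.

Context {T : Type} (op : T -> T -> T).

Hypothesis unique : forall S g g', merges op S g -> merges op S g' -> g = g'.
Hypothesis m7 : forall x y z, op (op (op x x) z) (op y y) = op (op (op y y) z) (op x x).
Hypothesis m8 : forall x y z, op (op z (op x x)) (op y y) = op (op z (op y y)) (op x x).

Lemma join_all (S1 S2 S3 : list (T * ty)) (g1 g2 : T) :
  (forall h, merges op S3 h -> merges op S1 h) ->
  (forall h, merges op S3 h -> merges op S2 h) ->
  feasible S3 -> merges op S1 g1 -> merges op S2 g2 -> g1 = g2.
Proof.
  intros H1 H2 F M1 M2; destruct (feasible_merges op S3 F) as [h Hh].
  transitivity h; [apply (unique S1) | symmetry; apply (unique S2)]; auto.
Qed.

(** This is M7 at a node of type [s]. In the feasibility hypothesis [x] merely stands for the value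
    of that node. *)
Lemma exchange_m7 (s : ty) (x y z : T) (R : list (T * ty)) (g g' : T) :
  feasible ((x, s) :: R) ->
  merges op ((x, tL s) :: (x, tR s) :: (y, s) :: (y, tLR s) :: (z, tLR s) :: R) g ->
  merges op ((y, tL s) :: (y, tR s) :: (x, s) :: (x, tLR s) :: (z, tLR s) :: R) g' ->
  g = g'.
Proof.
  intros F; apply (join_all _ _ ((op (op (op x x) z) (op y y), s) :: R));
    [intros h Hh | intros h Hh | exact F].
  - node x x s; node (op x x) z (tL s); node y y (tR s).
    node (op (op x x) z) (op y y) s; by_merges Hh.
  - node y y s; node (op y y) z (tL s); node x x (tR s).
    node (op (op y y) z) (op x x) s; rewrite m7; by_merges Hh.
Qed.

Lemma exchange_m8 (s : ty) (x y z : T) (R : list (T * ty)) (g g' : T) :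
  feasible ((x, s) :: R) ->
  merges op ((x, tL s) :: (x, tR s) :: (y, s) :: (y, tLR s) :: (z, s) :: R) g ->
  merges op ((y, tL s) :: (y, tR s) :: (x, s) :: (x, tLR s) :: (z, s) :: R) g' ->
  g = g'.
Proof.
  intros F; apply (join_all _ _ ((op (op z (op x x)) (op y y), s) :: R));
    [intros h Hh | intros h Hh | exact F].
  - node x x (tLR s); node y y (tR s); node z (op x x) (tL s).
    node (op z (op x x)) (op y y) s; by_merges Hh.
  - node y y (tLR s); node x x (tR s); node z (op y y) (tL s).
    node (op z (op y y)) (op x x) s; rewrite m8; by_merges Hh.
Qed.

(** Cherries in [R] are contracted as long as possible; then M7 or M8 applies, with a leaf of [R] as
    z. *)
Lemma exchange_two (x y : T) (R : list (T * ty)) (g g' : T) :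
  merges op (odd_pairs [x] ++ even_pairs [y] ++ R) g ->
  merges op (odd_pairs [y] ++ even_pairs [x] ++ R) g' -> g = g'.
Proof.
  cbn; remember (length R) as n eqn:En; revert R g g' En.
  induction n as [n IH] using (well_founded_induction Wf_nat.lt_wf); intros R g g' -> H1 H2.
  destruct (merges_feasible op _ _ H1) as [i Hi].
  destruct (fits_exchange _ i Hi) as [(r & Hc & Hr) | [(s & Hc & Hr) | (s & Hc & Hr)]];
    [intros q; unfold cnts; cbn; lia | | |];
    do 4 apply contains_cons in Hc; apply contains_pick in Hc as (c & R1 & HR & Hc).
  - apply contains_pick in Hc as (d & R2 & HR' & _); rewrite HR' in HR; clear HR' R1.
    retail HR H1; retail HR H2.
    assert (F : feasible ((x, (true, false)) :: (x, (false, true)) ::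
       (y, (false, false)) :: (y, (true, true)) :: (op c d, r) :: R2)).
    { apply (feasible_remove _ _ i [r] Hi Hr); count_types HR r. }
    destruct (feasible_merges op _ F) as [h Hh].
    destruct (feasible_merges op ((y, (true, false)) :: (y, (false, true)) ::
       (x, (false, false)) :: (x, (true, true)) :: (op c d, r) :: R2)) as [h' Hh'].
    (* Feasibility depends on the types alone, and exchanging [x] and [y] does not alter them. *)
    { exact F. }
    transitivity h; [| transitivity h'].
    + eapply unique; [exact H1 |]; node c d r; by_merges Hh.
    + eapply IH; [| reflexivity | exact Hh | exact Hh'].
      rewrite (Permutation_length HR); cbn; lia.
    + eapply unique; [| exact H2]; node c d r; by_merges Hh'.
  - retail HR H1; retail HR H2.
    assert (F : forall e : T, feasible ((e, s) :: R1)).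
    { intros e; apply (feasible_remove _ _ i _ Hi Hr); count_types HR s. }
    (* For [s] equal to 10 or 01, the types [tL s] and [tR s] are 00 and 11, so [x] and [y] trade
       roles. *)
    destruct s as [[] []].
    + apply (exchange_m7 (true, true) x y c R1); [apply F | by_merges H1 | by_merges H2].
    + apply (exchange_m7 (true, false) y x c R1); [apply F | by_merges H1 | by_merges H2].
    + apply (exchange_m7 (false, true) y x c R1); [apply F | by_merges H1 | by_merges H2].
    + apply (exchange_m7 (false, false) x y c R1); [apply F | by_merges H1 | by_merges H2].
  - retail HR H1; retail HR H2.
    assert (F : forall e : T, feasible ((e, s) :: R1)).
    { intros e; apply (feasible_remove _ _ i _ Hi Hr); count_types HR s. }
    destruct s as [[] []].
    + apply (exchange_m8 (true, true) x y c R1); [apply F | by_merges H1 | by_merges H2].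
    + apply (exchange_m8 (true, false) y x c R1); [apply F | by_merges H1 | by_merges H2].
    + apply (exchange_m8 (false, true) y x c R1); [apply F | by_merges H1 | by_merges H2].
    + apply (exchange_m8 (false, false) x y c R1); [apply F | by_merges H1 | by_merges H2].
Qed.

(** In M7 with y = uv, the two factors uv sit at [s] and [tLR s] on one side and at [tL s] and
    [tR s] on the other. Hence the pairs of [u] and [v] move in the same direction as that of
    [x]. *)
Lemma shift_m7 (s : ty) (x u v z : T) (R : list (T * ty)) (g g' : T) :
  feasible ((x, s) :: R) ->
  merges op ((x, tL s) :: (x, tR s) :: (u, tL s) :: (u, tR s) :: (v, tL s) :: (v, tR s) ::
             (z, tLR s) :: R) g ->
  merges op ((x, s) :: (x, tLR s) :: (u, s) :: (u, tLR s) :: (v, s) :: (v, tLR s) ::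
             (z, tLR s) :: R) g' ->
  g = g'.
Proof.
  intros F; apply (join_all _ _ ((op (op (op x x) z) (op (op u v) (op u v)), s) :: R));
    [intros h Hh | intros h Hh | exact F].
  - node u v s; node u v (tLR s); node x x s; node (op x x) z (tL s).
    node (op u v) (op u v) (tR s).
    node (op (op x x) z) (op (op u v) (op u v)) s; by_merges Hh.
  - node u v (tL s); node u v (tR s); node (op u v) (op u v) s.
    node (op (op u v) (op u v)) z (tL s); node x x (tR s).
    node (op (op (op u v) (op u v)) z) (op x x) s; rewrite m7; by_merges Hh.
Qed.

Lemma shift_m8 (s : ty) (x u v z : T) (R : list (T * ty)) (g g' : T) :
  feasible ((x, s) :: R) ->
  merges op ((x, tL s) :: (x, tR s) :: (u, tL s) :: (u, tR s) :: (v, tL s) :: (v, tR s) ::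
             (z, s) :: R) g ->
  merges op ((x, s) :: (x, tLR s) :: (u, s) :: (u, tLR s) :: (v, s) :: (v, tLR s) ::
             (z, s) :: R) g' ->
  g = g'.
Proof.
  intros F; apply (join_all _ _ ((op (op z (op x x)) (op (op u v) (op u v)), s) :: R));
    [intros h Hh | intros h Hh | exact F].
  - node x x (tLR s); node z (op x x) (tL s); node u v s; node u v (tLR s).
    node (op u v) (op u v) (tR s).
    node (op z (op x x)) (op (op u v) (op u v)) s; by_merges Hh.
  - node u v (tL s); node u v (tR s); node (op u v) (op u v) (tLR s); node x x (tR s).
    node z (op (op u v) (op u v)) (tL s).
    node (op z (op (op u v) (op u v))) (op x x) s; rewrite m8; by_merges Hh.
Qed.

Lemma shift_three (x u v : T) (R : list (T * ty)) (g g' : T) :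
  merges op (odd_pairs [x; u; v] ++ R) g ->
  merges op (even_pairs [x; u; v] ++ R) g' -> g = g'.
Proof.
  cbn; remember (length R) as n eqn:En; revert R g g' En.
  induction n as [n IH] using (well_founded_induction Wf_nat.lt_wf); intros R g g' -> H1 H2.
  destruct (merges_feasible op _ _ H1) as [i Hi], (merges_feasible op _ _ H2) as [j Hj].
  destruct (fun Hc => fits_shift _ i _ j Hi Hc Hj) as [(r & Hc & Hr & Hr') | [(s & Hc & Hr) | (s & Hc & Hr)]];
    [intros q; unfold cnts; cbn; lia | intros [[] []]; unfold cnts; cbn; lia | | |];
    do 6 apply contains_cons in Hc; apply contains_pick in Hc as (c & R1 & HR & Hc).
  - apply contains_pick in Hc as (d & R2 & HR' & _); rewrite HR' in HR; clear HR' R1.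
    retail HR H1; retail HR H2.
    destruct (feasible_merges op (odd_pairs [x; u; v] ++ (op c d, r) :: R2)) as [h Hh].
    { apply (feasible_remove _ _ i [r] Hi Hr); count_types HR r. }
    destruct (feasible_merges op (even_pairs [x; u; v] ++ (op c d, r) :: R2)) as [h' Hh'].
    { apply (feasible_remove _ _ j [r] Hj Hr'); count_types HR r. }
    cbn in Hh, Hh'.
    transitivity h; [| transitivity h'].
    + eapply unique; [exact H1 |]; node c d r; by_merges Hh.
    + eapply IH; [| reflexivity | exact Hh | exact Hh'].
      rewrite (Permutation_length HR); cbn; lia.
    + eapply unique; [| exact H2]; node c d r; by_merges Hh'.
  - retail HR H1; retail HR H2.
    assert (F : forall e : T, feasible ((e, s) :: R1)).
    (* The parity of [s] decides whether [Hr] speaks of [i] or of [j], that is, from which side the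
       subtree is contracted. *)
    { intros e; destruct s as [[] []];
        (apply (feasible_remove _ _ i _ Hi Hr) || apply (feasible_remove _ _ j _ Hj Hr));
        count_concrete HR. }
    destruct s as [[] []].
    + apply (shift_m7 (true, true) x u v c R1); [apply F | by_merges H1 | by_merges H2].
    + symmetry; apply (shift_m7 (true, false) x u v c R1); [apply F | by_merges H2 | by_merges H1].
    + symmetry; apply (shift_m7 (false, true) x u v c R1); [apply F | by_merges H2 | by_merges H1].
    + apply (shift_m7 (false, false) x u v c R1); [apply F | by_merges H1 | by_merges H2].
  - retail HR H1; retail HR H2.
    assert (F : forall e : T, feasible ((e, s) :: R1)).
    { intros e; destruct s as [[] []];
        (apply (feasible_remove _ _ i _ Hi Hr) || apply (feasible_remove _ _ j _ Hj Hr));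
        count_concrete HR. }
    destruct s as [[] []].
    + apply (shift_m8 (true, true) x u v c R1); [apply F | by_merges H1 | by_merges H2].
    + symmetry; apply (shift_m8 (true, false) x u v c R1); [apply F | by_merges H2 | by_merges H1].
    + symmetry; apply (shift_m8 (false, true) x u v c R1); [apply F | by_merges H2 | by_merges H1].
    + apply (shift_m8 (false, false) x u v c R1); [apply F | by_merges H1 | by_merges H2].
Qed.

Lemma shift_all (X : list T) (C : list (T * ty)) (g g' : T) :
  merges op (odd_pairs X ++ C) g -> merges op (even_pairs X ++ C) g' -> g = g'.
Proof.
  remember (length X) as n eqn:En; revert X C g g' En.
  induction n as [n IH] using (well_founded_induction Wf_nat.lt_wf); intros X C g g' -> H1 H2.
  destruct (PeanoNat.Nat.eq_dec (length X) 0) as [E | E].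
  { apply length_zero_iff_nil in E; subst X; exact (unique _ _ _ H1 H2). }
  destruct (merges_feasible op _ _ H1) as [i Hi], (merges_feasible op _ _ H2) as [j Hj].
  destruct (fits_between (length X) (cnts C) _ _ i j Hi Hj) as [HX F];
    [lia | intros r; now rewrite cnts_app, cnts_odd_pairs
    | intros r; now rewrite cnts_app, cnts_even_pairs |].
  destruct X as [|x [|u [|v X]]]; cbn in HX; try lia.
  destruct (feasible_merges op (even_pairs [x; u; v] ++ odd_pairs X ++ C)) as [h Hh].
  { refine (ex_intro _ _ (fits_ext _ _ _ _ F)); intros r.
    rewrite !cnts_app, cnts_odd_pairs, cnts_even_pairs; cbn [length].
    destruct xorb; lia. }
  transitivity h.
  - apply (shift_three x u v (odd_pairs X ++ C)); [exact H1 | exact Hh].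
  - apply (IH (length X)) with (X := X) (C := even_pairs [x; u; v] ++ C);
      [cbn; lia | reflexivity | |].
    + revert Hh; apply merges_perm, Permutation_app_swap_app.
    + revert H2; apply merges_perm;
      change (even_pairs (x :: u :: v :: X)) with (even_pairs [x; u; v] ++ even_pairs X).
      rewrite <- app_assoc; apply Permutation_app_swap_app.
Qed.

(** Elements of [X] are exchanged against elements of [Y] one by one; the surplus of the longer list
    is moved by [shift_all], three pairs at a time. *)
Lemma exchange_all (X Y : list T) (C : list (T * ty)) (g g' : T) :
  merges op (odd_pairs X ++ even_pairs Y ++ C) g ->
  merges op (even_pairs X ++ odd_pairs Y ++ C) g' -> g = g'.
Proof.
  revert Y C g g'; induction X as [|x X IH]; intros [|y Y] C g g' H1 H2.
  - exact (unique _ _ _ H1 H2).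
  - symmetry; exact (shift_all (y :: Y) C g' g H2 H1).
  - exact (shift_all (x :: X) C g g' H1 H2).
  - set (D := odd_pairs [y] ++ even_pairs [x]).
    assert (P1 : Permutation (odd_pairs (x :: X) ++ even_pairs (y :: Y) ++ C)
       (odd_pairs [x] ++ even_pairs [y] ++ odd_pairs X ++ even_pairs Y ++ C)).
    { change (odd_pairs (x :: X)) with (odd_pairs [x] ++ odd_pairs X).
      change (even_pairs (y :: Y)) with (even_pairs [y] ++ even_pairs Y).
      rewrite <- !app_assoc; apply Permutation_app_head, Permutation_app_swap_app. }
    assert (P2 : Permutation (even_pairs (x :: X) ++ odd_pairs (y :: Y) ++ C)
       (even_pairs X ++ odd_pairs Y ++ D ++ C)).
    { change (even_pairs (x :: X)) with (even_pairs [x] ++ even_pairs X).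
      change (odd_pairs (y :: Y)) with (odd_pairs [y] ++ odd_pairs Y).
      unfold D; rewrite <- !app_assoc.
      rewrite (Permutation_app_swap_app (odd_pairs Y)).
      rewrite (Permutation_app_swap_app (odd_pairs Y) (even_pairs [x])).
      rewrite (Permutation_app_swap_app (odd_pairs [y]) (even_pairs [x])).
      apply Permutation_app_swap_app. }
    apply (merges_perm op _ _ _ P1) in H1; apply (merges_perm op _ _ _ P2) in H2.
    destruct (feasible_merges op (D ++ odd_pairs X ++ even_pairs Y ++ C)) as [h Hh].
    { exact (merges_feasible op _ _ H1). }
    transitivity h.
    + apply (exchange_two x y (odd_pairs X ++ even_pairs Y ++ C)); [exact H1 | exact Hh].
    + apply (IH Y (D ++ C)); [| exact H2].
      revert Hh; apply merges_perm.
      rewrite (Permutation_app_swap_app D (odd_pairs X)).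
      apply Permutation_app_head, Permutation_app_swap_app.
Qed.
End Exchange.

(** * Identities of the integers in terms of typed occurrences *)

Lemma eval_ext {T : Type} (op op' : T -> T -> T) (v : nat -> T) (e : term) :
  (forall a b, op a b = op' a b) -> eval op v e = eval op' v e.
Proof. intros H; induction e as [k | e1 IH1 e2 IH2]; cbn; congruence. Qed.

Lemma map_leaves {A B : Type} (f : A -> B) (v : nat -> A) (e : term) (s : ty) :
  map (fun p => (f (fst p), snd p)) (leaves v e s) = leaves (fun k => f (v k)) e s.
Proof.
  revert s; induction e as [k | e1 IH1 e2 IH2]; intros s; cbn; [easy|].
  now rewrite map_app, IH1, IH2.
Qed.

Fixpoint occ (k : nat) (r : ty) (L : list (nat * ty)) : nat :=
  match L with
  | [] => 0
  | (j, s) :: L' => (if Nat.eqb j k && ty_eqb s r then 1 else 0) + occ k r L'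
  end.

Lemma occ_perm (k : nat) (r : ty) (L L' : list (nat * ty)) :
  Permutation L L' -> occ k r L = occ k r L'.
Proof.
  induction 1 as [| [j s] | [j s] [j' s'] |]; cbn; lia.
Qed.

Lemma occ_pick (k : nat) (r : ty) (L : list (nat * ty)) :
  1 <= occ k r L -> exists L', Permutation L ((k, r) :: L').
Proof.
  induction L as [|[j s] L IH]; cbn; [lia|].
  destruct (Nat.eqb j k && ty_eqb s r) eqn:E.
  - apply andb_prop in E as [E1 E2]; apply PeanoNat.Nat.eqb_eq in E1; apply ty_eqb_eq in E2.
    subst; now exists L.
  - intros H; destruct IH as [L' HL]; [lia|].
    exists ((j, s) :: L'); rewrite HL; apply perm_swap.
Qed.

Definition sign (al : Z) (b : bool) : Z := if b then al else 1%Z.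

Definition signed_occ (al be : Z) (k : nat) (L : list (nat * ty)) : Z :=
  (Z.of_nat (occ k (false, false) L) + be * Z.of_nat (occ k (false, true) L) +
   al * Z.of_nat (occ k (true, false) L) + al * be * Z.of_nat (occ k (true, true) L))%Z.

Definition indicator (k j : nat) : Z := if Nat.eqb j k then 1%Z else 0%Z.

Lemma signed_occ_app (al be : Z) (k : nat) (L L' : list (nat * ty)) :
  signed_occ al be k (L ++ L') = (signed_occ al be k L + signed_occ al be k L')%Z.
Proof.
  unfold signed_occ.
  assert (H : forall r, occ k r (L ++ L') = occ k r L + occ k r L').
  { intros r; induction L as [|[j s] L IH]; cbn; lia. }
  rewrite !H, !Nat2Z.inj_add; ring.
Qed.

(** A leaf gets a factor [al] for each left step and [be] for each right step; as their squares are
    1, only its type matters. The indicator valuation reads off the coefficient of the variable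
    [k]. *)
Lemma signed_occ_leaves (al be : Z) (k : nat) (e : term) (s : ty) :
  (al * al = 1)%Z -> (be * be = 1)%Z ->
  signed_occ al be k (leaves id e s) =
  (sign al (fst s) * sign be (snd s) *
   eval (fun a b => al * a + be * b) (indicator k) e)%Z.
Proof.
  intros Ha Hb; revert s; induction e as [j | e1 IH1 e2 IH2]; intros s.
  - unfold signed_occ, indicator, id; cbn [leaves eval occ].
    destruct (Nat.eqb j k), s as [[] []]; cbn -[Z.add Z.mul]; ring.
  - cbn [leaves eval]; rewrite signed_occ_app, IH1, IH2.
    unfold sign, tL, tR.
    destruct s as [[] []]; cbn [fst snd negb]; ring [Ha Hb].
Qed.

(** The three equations are half sums and a half difference of the equations for the three signed
    counts, so that no subtraction occurs. *)
Definition same_signs (L L' : list (nat * ty)) : Prop :=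
  forall k,
    occ k (false,false) L + occ k (false,true) L = occ k (false,false) L' + occ k (false,true) L' /\
    occ k (false,false) L + occ k (true,false) L = occ k (false,false) L' + occ k (true,false) L' /\
    occ k (true,true) L + occ k (true,false) L = occ k (true,true) L' + occ k (true,false) L'.

Lemma Sigma123_same_signs (e : identity) :
  Sigma123 e -> same_signs (leaves id (fst e) t00) (leaves id (snd e) t00).
Proof.
  intros (H1 & H2 & H3) k.
  assert (H : forall al be, (al * al = 1)%Z -> (be * be = 1)%Z ->
     satisfies (fun a b => al * a + be * b)%Z e ->
     signed_occ al be k (leaves id (fst e) t00) = signed_occ al be k (leaves id (snd e) t00)).
  { intros al be Ha Hb He; rewrite !signed_occ_leaves by easy; now rewrite (He (indicator k)). }
  assert (E : forall op op' : Z -> Z -> Z, satisfies op e ->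
     (forall a b, op a b = op' a b) -> satisfies op' e).
  { intros op op' He Ho v; rewrite <- !(eval_ext op op' v) by easy; apply He. }
  assert (F1 : signed_occ 1%Z 1%Z k (leaves id (fst e) t00) = signed_occ 1%Z 1%Z k (leaves id (snd e) t00))
    by (apply H; [easy.. | apply (E _ _ H1); intros; ring]).
  assert (F2 : signed_occ 1%Z (-1)%Z k (leaves id (fst e) t00) = signed_occ 1%Z (-1)%Z k (leaves id (snd e) t00))
    by (apply H; [easy.. | apply (E _ _ H2); intros; ring]).
  assert (F3 : signed_occ (-1)%Z 1%Z k (leaves id (fst e) t00) = signed_occ (-1)%Z 1%Z k (leaves id (snd e) t00))
    by (apply H; [easy.. | apply (E _ _ H3); intros; ring]).
  unfold signed_occ in *; lia.
Qed.

Lemma same_signs_cons (L L' M M' : list (nat * ty)) (p : nat * ty) :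
  Permutation L (p :: M) -> Permutation L' (p :: M') -> same_signs L L' -> same_signs M M'.
Proof.
  intros HL HL' H k; specialize (H k).
  rewrite !(occ_perm k _ _ _ HL), !(occ_perm k _ _ _ HL') in H.
  destruct p as [j s]; cbn in H; lia.
Qed.

Lemma same_signs_pairs (L L' M M' : list (nat * ty)) (k : nat) :
  Permutation L (odd_pairs [k] ++ M) -> Permutation L' (even_pairs [k] ++ M') ->
  same_signs L L' -> same_signs M M'.
Proof.
  intros HL HL' H j; specialize (H j).
  rewrite !(occ_perm j _ _ _ HL), !(occ_perm j _ _ _ HL') in H; cbn in H.
  destruct (Nat.eqb k j); cbn in H; lia.
Qed.

Lemma same_signs_sym (L L' : list (nat * ty)) : same_signs L L' -> same_signs L' L.
Proof. intros H k; specialize (H k); lia. Qed.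

Lemma occ_pick_pair (k : nat) (r s : ty) (L : list (nat * ty)) :
  r <> s -> 1 <= occ k r L -> 1 <= occ k s L ->
  exists M, Permutation L ((k, r) :: (k, s) :: M).
Proof.
  intros Hrs Hr Hs; apply occ_pick in Hr as [M HM].
  rewrite (occ_perm _ _ _ _ HM) in Hs; cbn in Hs.
  destruct (ty_eqb r s) eqn:E; [now apply ty_eqb_eq in E |].
  rewrite andb_false_r in Hs; apply occ_pick in Hs as [M' HM'].
  exists M'; now rewrite HM, HM'.
Qed.

(** A leaf occurring on both sides goes into [C]. If a type of [k] is present in [L] but missing in
    [L'], the counts of [k] differ by a nonzero multiple of (1,-1,-1,1), which yields a whole pair
    in [L] and the other kind of pair in [L']. *)
Lemma same_signs_decompose (L L' : list (nat * ty)) :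
  same_signs L L' ->
  exists X Y C, Permutation L (odd_pairs X ++ even_pairs Y ++ C) /\
                Permutation L' (even_pairs X ++ odd_pairs Y ++ C).
Proof.
  remember (length L) as n eqn:En; revert L L' En.
  induction n as [n IH] using (well_founded_induction Wf_nat.lt_wf); intros L L' -> H.
  destruct L as [|[k s] L].
  { destruct L' as [|[k s] L']; [now exists [], [], [] |].
    exfalso; specialize (H k); cbn in H; rewrite PeanoNat.Nat.eqb_refl in H.
    destruct s as [[] []]; cbn in H; lia. }
  destruct (Compare_dec.le_lt_dec 1 (occ k s L')) as [Hs | Hs].
  { apply occ_pick in Hs as [M' HM'].
    pose proof (same_signs_cons _ _ _ _ _ (Permutation_refl _) HM' H) as HM.
    destruct (IH (length L) ltac:(cbn; lia) L M' eq_refl HM) as (X & Y & C & HX & HY).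
    exists X, Y, ((k, s) :: C); rewrite HM', HX, HY; split.
    - rewrite !app_assoc; apply Permutation_middle.
    - rewrite !app_assoc; apply Permutation_middle. }
  assert (Hk : 1 <= occ k s ((k, s) :: L)).
  { cbn; rewrite PeanoNat.Nat.eqb_refl; now destruct s as [[] []]; cbn; lia. }
  set (L0 := (k, s) :: L) in *.
  destruct (xorb (fst s) (snd s)) eqn:Es.
  - assert (HM : exists M, Permutation L0 (odd_pairs [k] ++ M)).
    { apply occ_pick_pair; [discriminate | |];
        specialize (H k); destruct s as [[] []]; try discriminate; lia. }
    assert (HM' : exists M', Permutation L' (even_pairs [k] ++ M')).
    { apply occ_pick_pair; [discriminate | |];
        specialize (H k); destruct s as [[] []]; try discriminate; lia. }
    destruct HM as [M HM], HM' as [M' HM'].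
    pose proof (same_signs_pairs _ _ _ _ _ HM HM' H) as HMM.
    destruct (IH (length M)) with (L := M) (L' := M') as (X & Y & C & HX & HY);
      [rewrite (Permutation_length HM); cbn; lia | easy | easy |].
    exists (k :: X), Y, C; split; [rewrite HM, HX; reflexivity |].
    rewrite HM', HY; reflexivity.
  - assert (HM : exists M, Permutation L0 (even_pairs [k] ++ M)).
    { apply occ_pick_pair; [discriminate | |];
        specialize (H k); destruct s as [[] []]; try discriminate; lia. }
    assert (HM' : exists M', Permutation L' (odd_pairs [k] ++ M')).
    { apply occ_pick_pair; [discriminate | |];
        specialize (H k); destruct s as [[] []]; try discriminate; lia. }
    destruct HM as [M HM], HM' as [M' HM'].
    pose proof (same_signs_pairs _ _ _ _ _ HM' HM (same_signs_sym _ _ H)) as HMM.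
    destruct (IH (length M)) with (L := M) (L' := M') as (X & Y & C & HX & HY);
      [rewrite (Permutation_length HM); cbn; lia | easy | now apply same_signs_sym |].
    exists X, (k :: Y), C; split.
    + rewrite HM, HX; exact (Permutation_app_swap_app (even_pairs [k]) _ (even_pairs Y ++ C)).
    + rewrite HM', HY; exact (Permutation_app_swap_app (odd_pairs [k]) _ (odd_pairs Y ++ C)).
Qed.

Lemma map_odd_pairs {A B : Type} (f : A -> B) (X : list A) :
  map (fun p => (f (fst p), snd p)) (odd_pairs X) = odd_pairs (map f X).
Proof. induction X as [|a X IH]; cbn; [easy|]; now do 2 f_equal. Qed.

Lemma map_even_pairs {A B : Type} (f : A -> B) (X : list A) :
  map (fun p => (f (fst p), snd p)) (even_pairs X) = even_pairs (map f X).
Proof. induction X as [|a X IH]; cbn; [easy|]; now do 2 f_equal. Qed.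

Lemma merges_eval {T : Type} (op : T -> T -> T) (v : nat -> T) (e : term) :
  merges op (map (fun p => (v (fst p), snd p)) (leaves id e t00)) (eval op v e).
Proof.
  rewrite map_leaves, <- (app_nil_r (leaves _ _ _)).
  apply merges_leaves; constructor.
Qed.

(** * The identities form a basis *)

Definition valuation {T : Type} (a b c d : T) (k : nat) : T :=
  match k with 0 => a | 1 => b | 2 => c | _ => d end.

Lemma B123_complete (e : identity) : Sigma123 e -> consequence (fun d => In d B123) e.
Proof.
  intros He T op HB v.
  assert (A : forall d a b c f, In d B123 ->
    eval op (valuation a b c f) (fst d) = eval op (valuation a b c f) (snd d)).
  { intros d a b c f Hd; apply (HB d Hd). }
  destruct (same_signs_decompose _ _ (Sigma123_same_signs e He)) as (X & Y & C & HL & HL').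
  pose proof (merges_eval op v (fst e)) as G; pose proof (merges_eval op v (snd e)) as G'.
  apply (merges_perm op _ _ _ (Permutation_map _ HL)) in G.
  apply (merges_perm op _ _ _ (Permutation_map _ HL')) in G'.
  rewrite !map_app, map_odd_pairs, map_even_pairs in G, G'.
  revert G G'; apply exchange_all.
  - intros S g g'; apply unique_value; intros a b c f.
    + apply (A M1 a b c f); cbn; tauto.
    + apply (A M2 a b c f); cbn; tauto.
    + apply (A M3 a b c f); cbn; tauto.
    + apply (A M4 a b c f); cbn; tauto.
    + apply (A M5 a b c f); cbn; tauto.
    + apply (A M6 a b c f); cbn; tauto.
  (* M7 and M8 have only three variables; the last argument is a dummy value. *)
  - intros a b c; apply (A M7 a b c c); cbn; tauto.
  - intros a b c; apply (A M8 a b c c); cbn; tauto.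
Qed.

Lemma B123_sound (e : identity) : consequence (fun d => In d B123) e -> Sigma123 e.
Proof.
  intros H; repeat split; apply H; intros d Hd v;
    repeat (destruct Hd as [<- | Hd]; [cbn; ring |]); destruct Hd.
Qed.

(** * Independence by finite countermodels *)

Fixpoint vars_below (n : nat) (e : term) : bool :=
  match e with
  | Var k => Nat.ltb k n
  | Op e1 e2 => vars_below n e1 && vars_below n e2
  end.

Lemma eval_vars_below {T : Type} (op : T -> T -> T) (v w : nat -> T) (n : nat) (e : term) :
  vars_below n e = true -> (forall k, k < n -> v k = w k) -> eval op v e = eval op w e.
Proof.
  intros He Hv; induction e as [k | e1 IH1 e2 IH2]; cbn in *.
  - now apply Hv, PeanoNat.Nat.ltb_lt.
  - apply andb_prop in He as [He1 He2]; now rewrite IH1, IH2.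
Qed.

Definition satisfies_on {T : Type} (elems : list T) (eqb : T -> T -> bool)
    (op : T -> T -> T) (e : identity) : bool :=
  forallb (fun a => forallb (fun b => forallb (fun c => forallb (fun d =>
    eqb (eval op (valuation a b c d) (fst e)) (eval op (valuation a b c d) (snd e)))
    elems) elems) elems) elems.

Lemma satisfies_on_sound {T : Type} (elems : list T) (eqb : T -> T -> bool)
    (op : T -> T -> T) (e : identity) :
  (forall a, In a elems) -> (forall a b, eqb a b = true -> a = b) ->
  vars_below 4 (fst e) && vars_below 4 (snd e) = true ->
  satisfies_on elems eqb op e = true -> satisfies op e.
Proof.
  intros HI HE He H v.
  apply andb_prop in He as [He1 He2].
  assert (Hv : forall k, k < 4 -> v k = valuation (v 0) (v 1) (v 2) (v 3) k).
  { intros k Hk; do 4 (destruct k as [|k]; [easy |]); lia. }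
  rewrite (eval_vars_below op v _ 4 _ He1 Hv), (eval_vars_below op v _ 4 _ He2 Hv).
  apply HE; unfold satisfies_on in H.
  rewrite forallb_forall in H; specialize (H (v 0) (HI _)); cbv beta in H.
  rewrite forallb_forall in H; specialize (H (v 1) (HI _)); cbv beta in H.
  rewrite forallb_forall in H; specialize (H (v 2) (HI _)); cbv beta in H.
  rewrite forallb_forall in H; exact (H (v 3) (HI _)).
Qed.

(** With variables restricted to the first four, satisfaction in a finite groupoid becomes a finite
    check done by computation. *)
Lemma not_consequence {T : Type} (elems : list T) (eqb : T -> T -> bool)
    (op : T -> T -> T) (E : list identity) (e : identity) (a b c d : T) :
  (forall a, In a elems) -> (forall a b, eqb a b = true -> a = b) ->
  forallb (fun e' => vars_below 4 (fst e') && vars_below 4 (snd e')) E = true ->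
  forallb (satisfies_on elems eqb op) E = true ->
  eval op (valuation a b c d) (fst e) <> eval op (valuation a b c d) (snd e) ->
  ~ consequence (fun e' => In e' E) e.
Proof.
  intros HI HE HV HS Hne H; apply Hne; revert Hne; intros _.
  apply (H T op); intros e' He'; rewrite forallb_forall in HV, HS.
  apply (satisfies_on_sound elems eqb op e' HI HE); auto.
Qed.

Inductive six : Type := s0 | s1 | s2 | s3 | s4 | s5.
Scheme Equality for six.

Inductive twelve : Type :=
  e0 | e1 | e2 | e3 | e4 | e5 | e6 | e7 | e8 | e9 | e10 | e11.
Scheme Equality for twelve.

Definition all_six : list six := [s0; s1; s2; s3; s4; s5].
Definition all_twelve : list twelve := [e0; e1; e2; e3; e4; e5; e6; e7; e8; e9; e10; e11].

Lemma in_all_six (a : six) : In a all_six.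
Proof. destruct a; cbn; tauto. Qed.

Lemma in_all_twelve (a : twelve) : In a all_twelve.
Proof. destruct a; cbn; tauto. Qed.

(* In the first six, 1 and 2 are generators, 0 is a zero, and 3, 4, 5 are the
   nonzero products, 5 being one side of an instance of the refuted identity. *)
Definition countermodel1 (a b : six) : six :=
  match a, b with s1, s1 => s3 | s2, s1 => s4 | s3, s4 => s5 | _, _ => s0 end.
Definition countermodel2 (a b : six) : six :=
  match a, b with s1, s1 => s3 | s1, s2 => s4 | s3, s4 => s5 | _, _ => s0 end.
Definition countermodel3 (a b : six) : six :=
  match a, b with s1, s1 => s3 | s3, s1 => s4 | s4, s2 => s5 | _, _ => s0 end.
Definition countermodel4 (a b : six) : six :=
  match a, b with s1, s1 => s3 | s1, s3 => s4 | s4, s2 => s5 | _, _ => s0 end.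
Definition countermodel5 (a b : six) : six :=
  match a, b with s1, s1 => s3 | s3, s1 => s4 | s2, s4 => s5 | _, _ => s0 end.
Definition countermodel6 (a b : six) : six :=
  match a, b with s1, s1 => s3 | s1, s3 => s4 | s2, s4 => s5 | _, _ => s0 end.

(* Here 11 is the value of ((1 1) 2) (2 2), and of all terms in which the
   generators 1 and 2 have the same numbers of leaves of each type. *)
Definition countermodel7 (a b : twelve) : twelve :=
  match a, b with
  | e1, e1 => e4 | e1, e3 => e8 | e1, e9 => e11
  | e2, e2 => e3 | e2, e4 => e6 | e2, e5 => e9
  | e3, e1 => e5 | e3, e6 => e11
  | e4, e2 => e7
  | e7, e3 => e11
  | e8, e2 => e10
  | e10, e1 => e11
  | _, _ => e0
  end.

(* As before, with (2 (1 1)) (2 2). *)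
Definition countermodel8 (a b : twelve) : twelve :=
  match a, b with
  | e1, e1 => e4 | e1, e3 => e5 | e1, e9 => e11
  | e2, e2 => e3 | e2, e4 => e7 | e2, e8 => e10
  | e3, e1 => e8 | e3, e6 => e11
  | e4, e2 => e6
  | e5, e2 => e9
  | e7, e3 => e11
  | e10, e1 => e11
  | _, _ => e0
  end.

Ltac by_model op a b c d :=
  first [ apply (not_consequence all_six six_beq op _ _ a b c d in_all_six internal_six_dec_bl)
        | apply (not_consequence all_twelve twelve_beq op _ _ a b c d in_all_twelve
                   internal_twelve_dec_bl) ];
  [reflexivity | vm_compute; reflexivity | discriminate].

Lemma B123_independent : independent B123.
Proof.
  intros i Hi d.
  destruct i as [|[|[|[|[|[|[|[|i]]]]]]]]; [.. | cbn in Hi; lia]; cbn [nth remove_nth B123].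
  (* The arguments are values of x, y, z, t at which the left side of the refuted identity is 5, or
     11 in the last two models, and the right side is 0. *)
  - by_model countermodel1 s1 s1 s2 s1.
  - by_model countermodel2 s1 s1 s1 s2.
  - by_model countermodel3 s1 s1 s1 s2.
  - by_model countermodel4 s1 s1 s1 s2.
  - by_model countermodel5 s2 s1 s1 s1.
  - by_model countermodel6 s2 s1 s1 s1.
  - by_model countermodel7 e1 e2 e2 e2.
  - by_model countermodel8 e1 e2 e2 e2.
Qed.

Theorem theorem5p1 : is_basis B123 Sigma123 /\ independent B123.
Proof.
  split; [| exact B123_independent].
  intros e; split; [apply B123_sound | apply B123_complete].
Qed.
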